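(* Let $\sigma$ be a real $d\times d$ matrix and let $b(x)=\alpha+Cx$ for $x\in\mathbb{R}^d$, where $\alpha\in\mathbb{R}^d$ and $C$ is a real $d\times d$ matrix. Let $\psi\in\mathcal{L}^1(\mathbb{R}^d)$ and $\omega\in\Omega\setminus\mathcal{N}$, with $\mathcal{N}$, $X(t,x)$ and $Y_t(\psi)$ as defined in the context. Then for every $t\ge0$ the tempered distribution $Y_t(\psi)=Y_t(\omega)(\psi)$ is given by the integrable function $$Y_t(\psi)=e^{-t\,\mathrm{tr}(C)}\,\tau_{Z_t}\psi_t,$$ where $Z_t:=X(t,0)$, $\psi_t(x):=\psi(e^{-tC}x)$ for $x\in\mathbb{R}^d$, $(\tau_zg)(y):=g(y-z)$, and $\mathrm{tr}(C)$ is the trace of $C$.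
   Context: $(\Omega,\mathcal{F},(\mathcal{F}_t),P)$ is a filtered complete probability space satisfying the usual conditions, and $\{B_t\}$ is a standard $d$-dimensional $(\mathcal{F}_t)$ Brownian motion. $\mathcal{L}^1(\mathbb{R}^d)$ is the space of Lebesgue integrable functions, regarded as a subspace of the tempered distributions $\mathcal{S}'(\mathbb{R}^d)$. $\{X(t,0)\}$ is the continuous solution of $dX_t=\sigma\,dB_t+(\alpha+CX_t)\,dt$, $X_0=0$, and $X(t,x):=X(t,0)+e^{tC}x$. $\mathcal{N}$ is a $P$-null set outside of which $t\mapsto X(t,0)$ is continuous and $X(t,x)=x+\int_0^t\sigma\,dB_s+\alpha t+\int_0^tCX(s,x)\,ds$ for all $t\ge0$, $x\in\mathbb{R}^d$. For $\omega\in\Omega\setminus\mathcal{N}$, $Y_t(\omega)(\psi):=\int_{\mathbb{R}^d}\psi(x)\,\delta_{X(t,x,\omega)}\,dx$, where $\delta_y$ is the Dirac distribution at $y$; as a tempered distribution, $\langle Y_t(\omega)(\psi),\phi\rangle=\int_{\mathbb{R}^d}\psi(x)\,\phi(X(t,x,\omega))\,dx$ for $\phi\in\mathcal{S}(\mathbb{R}^d)$, the space of rapidly decreasing smooth functions. *)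

(* Defs.v *)
From HB Require Import structures.
From mathcomp Require Import all_boot all_order all_algebra.
From mathcomp Require Import all_classical all_reals all_analysis.

Set Implicit Arguments.
Unset Strict Implicit.
Unset Printing Implicit Defensive.

Import Order.TTheory GRing.Theory Num.Theory.
Import numFieldNormedType.Exports.

Local Open Scope classical_set_scope.
Local Open Scope ring_scope.

(* The space R^d is 'cV[R]_d (column vectors), with the sup norm and topology
   of MathComp-Analysis.  Its sigma-algebra is the product (Borel) one, generated
   by the coordinates. *)
Section borel_cV.
Context {R : realType} {n : nat}.

Definition cV_coord (i : 'I_n) (v : 'cV[R]_n) : measurableTypeR R := v i 0.

Let cV_set0 : g_sigma_preimage cV_coord set0.
Proof. exact: sigma_algebra0. Qed.

Let cV_setC A : g_sigma_preimage cV_coord A -> g_sigma_preimage cV_coord (~` A).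
Proof. exact: sigma_algebraC. Qed.

Let cV_bigcup (F : _^nat) : (forall i, g_sigma_preimage cV_coord (F i)) ->
  g_sigma_preimage cV_coord (\bigcup_i (F i)).
Proof. exact: sigma_algebra_bigcup. Qed.

HB.instance Definition _ := @isMeasurable.Build default_measure_display
  'cV[R]_n (g_sigma_preimage cV_coord) cV_set0 cV_setC cV_bigcup.

Lemma measurable_cV_coord (i : 'I_n) : measurable_fun setT (cV_coord i).
Proof.
move=> _ Y mY; rewrite setTI; apply: sub_sigma_algebra => /=.
rewrite -bigcup_seq/=; exists i => /=; first by rewrite mem_index_enum.
by exists Y => //; rewrite setTI.
Qed.

Lemma measurable_fun_cV_coordP d (T : measurableType d) (f : T -> 'cV[R]_n) :
  (forall i, measurable_fun setT (cV_coord i \o f)) -> measurable_fun setT f.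
Proof.
move=> mf.
have prefS : g_sigma_preimage (fun i => cV_coord i \o f) `<=` measurable.
  apply: smallest_sub; first exact: sigma_algebra_measurable.
  rewrite -bigcup_seq/=; apply: bigcup_sub => i _.
  by move=> A [B mB <-]; exact: mf.
move=> _ A mA; apply: prefS; rewrite g_sigma_preimage_comp; exists A => //.
Qed.

End borel_cV.

Section lebesgue_cV.
Context {R : realType}.

Definition consv n (p : measurableTypeR R * 'cV[R]_n) : 'cV[R]_n.+1 :=
  col_mx (p.1)%:M p.2.

Lemma consv0E n p : @consv n p ord0 0 = p.1.
Proof.
rewrite /consv (_ : ord0 = lshift n ord0 :> 'I_(1 + n)); last exact/val_inj.
by rewrite (@col_mxEu _ 1 n) mxE eqxx mulr1n.
Qed.

Lemma consvSE n p (i : 'I_n) : @consv n p (lift ord0 i) 0 = p.2 i 0.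
Proof.
rewrite /consv (_ : lift ord0 i = rshift 1 i :> 'I_(1 + n)); last exact/val_inj.
by rewrite (@col_mxEd _ 1 n).
Qed.

Lemma measurable_consv n : measurable_fun setT (@consv n).
Proof.
apply: measurable_fun_cV_coordP => i.
have [j ->|->] := unliftP ord0 i.
- rewrite (_ : _ \o _ = cV_coord j \o snd).
    by apply: measurableT_comp => //; exact: measurable_cV_coord.
  by apply/funext => p; rewrite /= /cV_coord consvSE.
- rewrite (_ : _ \o _ = fst) //.
  by apply/funext => p; rewrite /= /cV_coord consv0E.
Qed.

HB.instance Definition _ n := isMeasurableFun.Build _ _ _ _ (@consv n)
  (@measurable_consv n).

Section step.
Variables (n : nat) (m : {sigma_finite_measure set 'cV[R]_n -> \bar R}).

Definition lebesgue_step : set 'cV[R]_n.+1 -> \bar R :=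
  pushforward (lebesgue_measure \x m)%E (@consv n).

Let step0 : lebesgue_step set0 = 0%E.
Proof. exact: measure0. Qed.

Let step_ge0 A : (0 <= lebesgue_step A)%E.
Proof. exact: measure_ge0. Qed.

Let step_sigma_additive : semi_sigma_additive lebesgue_step.
Proof.
apply: measure_semi_sigma_additive; exact: measurable_consv.
Qed.

HB.instance Definition _ := isMeasure.Build _ _ _ lebesgue_step
  step0 step_ge0 step_sigma_additive.

Let step_sigma_finite : sigma_finite setT lebesgue_step.
Proof.
have /sigma_finiteP[F [TF ndF Foo]] := sigma_finiteT (@lebesgue_measure R).
have /sigma_finiteP[G [TG ndG Goo]] := sigma_finiteT m.
pose uncons (v : 'cV[R]_n.+1) : measurableTypeR R * 'cV[R]_n :=
  (v ord0 0, \col_i v (lift ord0 i) 0).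
have unconsK : cancel (@consv n) uncons.
  move=> [a u]; rewrite /uncons consv0E; congr (_, _).
  by apply/colP => i; rewrite mxE consvSE.
have muncons : measurable_fun setT uncons.
  apply/measurable_fun_pairP; split.
    exact: (measurable_cV_coord ord0).
  apply: measurable_fun_cV_coordP => i.
  rewrite (_ : _ \o _ = cV_coord (lift ord0 i)); first exact: measurable_cV_coord.
  by apply/funext => v; rewrite /= /cV_coord /= mxE.
exists (fun k => uncons @^-1` (F k `*` G k)).
  rewrite -preimage_bigcup (_ : \bigcup_k _ = setT) ?preimage_setT//.
  apply/seteqP; split => // -[x y] _.
  have [i _ Fix] : (\bigcup_k F k) x by rewrite -TF.
  have [j _ Gjy] : (\bigcup_k G k) y by rewrite -TG.
  exists (maxn i j) => //; split.
    by move: x Fix; exact/subsetPset/ndF/leq_maxl.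
  by move: y Gjy; exact/subsetPset/ndG/leq_maxr.
move=> k; have [mF Fk] := Foo k; have [mG Gk] := Goo k; split.
  by rewrite -[X in measurable X]setTI; apply: muncons => //; exact: measurableX.
rewrite /lebesgue_step /pushforward -comp_preimage.
rewrite (_ : uncons \o _ = id) ?preimage_id; last first.
  by apply/funext => p /=; rewrite unconsK.
by rewrite product_measure1E// lte_mul_pinfty// ge0_fin_numE.
Qed.

HB.instance Definition _ := @Measure_isSigmaFinite.Build _ _ _ lebesgue_step
  step_sigma_finite.

End step.

Fixpoint borel_lebesgue n : {sigma_finite_measure set 'cV[R]_n -> \bar R} :=
  match n return {sigma_finite_measure set 'cV[R]_n -> \bar R} with
  | 0 => dirac (0 : 'cV[R]_0)
  | k.+1 => lebesgue_step (borel_lebesgue k)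
  end.

End lebesgue_cV.

(* Lebesgue measure on R^d, defined on the sigma-algebra of Lebesgue measurable sets:
   the completion of the d-fold product of the Lebesgue measure of R. *)
Definition lebesgue_cV (R : realType) d : set _ -> \bar R :=
  @completed_measure_extension _ 'cV[R]_d R (borel_lebesgue d).
HB.instance Definition _ (R : realType) d := Measure.on (@lebesgue_cV R d).
Arguments lebesgue_cV : clear implicits.

(* L^1(R^d); a class modulo a.e. equality is represented by any of its members. *)
Definition L1 (R : realType) d (f : 'cV[R]_d -> R) :=
  (lebesgue_cV R d).-integrable setT (fun x => (f x)%:E).

Definition integral_cV (R : realType) d (f : 'cV[R]_d -> R) : R :=
  \int[lebesgue_cV R d]_x f x.

Section schwartz.
Context {R : realType} {d : nat}.
Implicit Types (f g phi : 'cV[R]_d -> R) (s : seq 'I_d) (k : nat).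

(* partials [:: i1; ...; ik] f is the partial derivative d_{i1} ... d_{ik} f. *)
Definition partials s f : 'cV[R]_d -> R :=
  foldr (fun i g x => 'D_(delta_mx i 0) g x) f s.

Definition smooth f := forall s, continuous (partials s f) /\
  forall i x, derivable (partials s f) x (delta_mx i 0).

Definition seminorm_values k s f : set R :=
  [set `|x| ^+ k * `|partials s f x| | x in [set: 'cV[R]_d]].

Definition schwartz f :=
  smooth f /\ forall k s, has_ubound (seminorm_values k s f).

Definition seminorm k s f : R := sup (seminorm_values k s f).

(* A functional on S(R^d) is represented by a function defined on all functions
   R^d -> R, whose values outside of S(R^d) are irrelevant. *)
Implicit Types u : ('cV[R]_d -> R) -> R.

(* Continuity of a linear functional for the Frechet topology of S(R^d): it is
   bounded by finitely many seminorms. *)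
Definition tempered_distribution u :=
  (forall (a : R) f g, schwartz f -> schwartz g ->
     u (fun x => a * f x + g x) = a * u f + u g) /\
  exists (M : R) (l : seq (nat * seq 'I_d)), forall f, schwartz f ->
    `|u f| <= M * \sum_(p <- l) seminorm p.1 p.2 f.

Definition eq_distribution u1 u2 := forall phi, schwartz phi -> u1 phi = u2 phi.

(* The embedding of L^1(R^d) in S'(R^d). *)
Definition distribution_of g phi : R := integral_cV (fun x => g x * phi x).

Definition given_by u g := L1 g /\ eq_distribution u (distribution_of g).

Definition dirac_distribution (y : 'cV[R]_d) phi : R := phi y.

Definition translate (z : 'cV[R]_d) f : 'cV[R]_d -> R := fun y => f (y - z).

End schwartz.

Definition expmx (R : realType) d (A : 'M[R]_d) : 'M[R]_d :=
  limn (series (fun k : nat => (k`!%:R)^-1 *: A ^+ k)).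

Section stochastic.
Context {R : realType} {dO : measure_display} {Omega : measurableType dO}.
Variable P : probability Omega R.
Variable F : R -> set (set Omega).

(* Time is the half-line t >= 0 of R: values at t < 0 are never used. *)
Record filtration : Prop := {
  filtration_sigma_algebra : forall t : R, 0 <= t -> sigma_algebra setT (F t) ;
  filtration_sub : forall t : R, 0 <= t -> F t `<=` measurable ;
  filtration_mono : forall s t : R, 0 <= s -> s <= t -> F s `<=` F t }.

Record usual_conditions : Prop := {
  usual_filtration : filtration ;
  usual_null : forall A, P.-negligible A -> F 0 A ;
  usual_right_continuous : forall t : R, 0 <= t ->
    F t = \bigcap_(s in [set s : R | t < s]) F s }.

Definition adapted d (X : R -> Omega -> 'cV[R]_d) :=
  forall t : R, 0 <= t -> forall A, measurable A -> F t (X t @^-1` A).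

Definition continuous_path d (X : R -> Omega -> 'cV[R]_d) (w : Omega) :=
  {within `[0, +oo[, continuous (X ^~ w)}.

Definition increment d (X : R -> Omega -> 'cV[R]_d) (s t : R) (w : Omega) :=
  X t w - X s w.

Record brownian_motion d (B : R -> Omega -> 'cV[R]_d) : Prop := {
  bm_adapted : adapted B ;
  bm0 : {ae P, forall w, B 0 w = 0} ;
  bm_continuous : {ae P, forall w, continuous_path B w} ;
  bm_independent : forall s t : R, 0 <= s -> s <= t ->
    forall (E : set Omega) (A : set 'cV[R]_d), F s E -> measurable A ->
    P (E `&` increment B s t @^-1` A) =
    (P E * P (increment B s t @^-1` A))%E ;
  (* the second parameter of normal_prob is the standard deviation *)
  bm_gaussian : forall s t : R, 0 <= s -> s < t ->
    forall A : 'I_d -> set (measurableTypeR R), (forall i, measurable (A i)) ->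
    P [set w | forall i, A i (increment B s t w i 0)] =
    (\prod_(i < d) normal_prob 0 (Num.sqrt (t - s)) (A i))%E }.

End stochastic.

Section linear_sde.
Context {R : realType} {dO : measure_display} {Omega : measurableType dO} {d : nat}.
Variables (B : R -> Omega -> 'cV[R]_d).
Variables (sigma C : 'M[R]_d) (alpha : 'cV[R]_d).
Implicit Types (X : R -> Omega -> 'cV[R]_d) (w : Omega) (x : 'cV[R]_d).

(* The Ito integral of the constant integrand sigma over [0, t] is
   sigma (B_t - B_0), by its definition on simple integrands. *)
Definition ito_const t w : 'cV[R]_d := sigma *m (B t w - B 0 w).

Definition integral0 (f : R -> 'cV[R]_d) (t : R) : 'cV[R]_d :=
  \col_i \int[lebesgue_measure]_(s in `[0, t]) f s i 0.

Definition sde_equation X x w := forall t : R, 0 <= t ->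
  X t w = x + ito_const t w + t *: alpha + integral0 (fun s => C *m X s w) t.

Definition sde_solution (P : probability Omega R) (F : R -> set (set Omega)) X x :=
  [/\ adapted F X, {ae P, forall w, continuous_path X w} &
      {ae P, forall w, sde_equation X x w}].

Definition flow (X0 : R -> Omega -> 'cV[R]_d) t x w : 'cV[R]_d :=
  X0 t w + expmx (t *: C) *m x.

End linear_sde.

(* Y_t(w)(psi) = \int psi(x) delta_{X(t,x,w)} dx, as a functional of test functions. *)
Definition Ydist (R : realType) (dO : measure_display) (Omega : measurableType dO) d
    (C : 'M[R]_d) (X0 : R -> Omega -> 'cV[R]_d) (t : R) (w : Omega)
    (psi phi : 'cV[R]_d -> R) : R :=
  integral_cV (fun x => psi x * dirac_distribution (flow C X0 t x w) phi).

(* Main.v *)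
(* Write X(t,x) = Z + E x with E = e^{tC}.  The integral over x of psi(x) phi(Z + E x) is
   turned into an integral of phi by the change of variables y = Z + E x, which multiplies
   Lebesgue measure by |det E|, and det E = e^{t tr C}.

   For the Borel product measure, the scaling under an invertible matrix is proved by
   induction on the dimension: after making the upper left entry nonzero, a matrix is a lower
   block triangular matrix times an upper shear, and each factor is handled by Fubini, slicing
   in one of the two directions.  The outer measure then scales on all sets, hence so do the
   Caratheodory measurable sets and the completed measure.

   For the exponential, the entries of e^{tC} are power series in t; Jacobi's formula shows
   that det(e^{tC}) e^{-t tr C} has zero derivative. *)
Require Import Defs.
From mathcomp Require Import all_boot all_order all_algebra.
From mathcomp Require Import all_classical all_reals all_analysis.
From mathcomp Require Import perm measurable_realfun ring lra.
Import Order.TTheory GRing.Theory Num.Theory.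
Import numFieldNormedType.Exports.
Local Open Scope classical_set_scope.
Local Open Scope ring_scope.

Set Implicit Arguments.
Unset Strict Implicit.
Unset Printing Implicit Defensive.

(** * Maps that scale a measure *)

Section measure_scaling.
Context {R : realType}.

(** Stated for preimages: the pushforward of [mu] under [f] is [c] times [mu], so for an invertible
    affine map [c] is the reciprocal of the Jacobian. *)
Definition scales d (T : measurableType d) (mu : set T -> \bar R) (c : R)
    (f : T -> T) :=
  measurable_fun setT f /\
  forall A, measurable A -> mu (f @^-1` A) = (c%:E * mu A)%E.

Lemma measurable_preimage d1 d2 (T1 : measurableType d1) (T2 : measurableType d2)
    (f : T1 -> T2) (A : set T2) :
  measurable_fun setT f -> measurable A -> measurable (f @^-1` A).
Proof. by move=> mf mA; rewrite -[X in measurable X]setTI; exact: mf. Qed.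

Lemma scales_id d (T : measurableType d) (mu : set T -> \bar R) : scales mu 1 id.
Proof. by split => [|A mA]; [exact: measurable_id|rewrite mul1e]. Qed.

Lemma scales_comp d (T : measurableType d) (mu : set T -> \bar R) c1 c2 f1 f2 :
  scales mu c1 f1 -> scales mu c2 f2 -> scales mu (c2 * c1) (f1 \o f2).
Proof.
move=> [mf1 s1] [mf2 s2]; split; first exact: measurableT_comp.
move=> A mA; rewrite comp_preimage s2; last exact: measurable_preimage.
by rewrite s1// muleA EFinM.
Qed.

Lemma integral_scales d (T : measurableType d)
    (mu : {measure set T -> \bar R}) c f (h : T -> \bar R) :
  0 <= c -> scales mu c f -> measurable_fun setT h -> (forall x, 0 <= h x)%E ->
  (\int[mu]_x h (f x) = c%:E * \int[mu]_x h x)%E.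
Proof.
move=> c0 [mf sf] mh h0.
rewrite -(ge0_integral_mscale mu measurableT (NngNum c0))//.
rewrite -[LHS]/(\int[mu]_(x in f @^-1` setT) (h \o f) x)%E.
rewrite -ge0_integral_pushforward//.
by apply: eq_measure_integral => A mA _; exact: sf.
Qed.

Section product.
Context d1 d2 (T1 : measurableType d1) (T2 : measurableType d2).
Variables (m1 : {sigma_finite_measure set T1 -> \bar R}).
Variables (m2 : {sigma_finite_measure set T2 -> \bar R}).

(** The reversed iterated integral agrees with the product measure on rectangles, which determine
    it. *)
Lemma product_measure1_ysection A : measurable A ->
  ((m1 \x m2) A = \int[m2]_y m1 (ysection A y))%E.
Proof.
move=> mA; rewrite (product_measure_unique (m' := (m1 \x^ m2)%E))// => B C mB mC.
exact: product_measure2E.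
Qed.

(** The slice at [x] of the preimage of [A] is the preimage under [g x] of the slice of [A] at
    [f x]. The inner measure contributes [c2], the outer integral [c1]. *)
Lemma scales_product_xsection c1 c2 (f : T1 -> T1) (g : T1 -> T2 -> T2) :
  0 <= c1 -> 0 <= c2 -> scales m1 c1 f -> (forall x, scales m2 c2 (g x)) ->
  measurable_fun setT (fun p : T1 * T2 => g p.1 p.2) ->
  scales (m1 \x m2)%E (c1 * c2) (fun p => (f p.1, g p.1 p.2)).
Proof.
move=> c10 c20 sf sg mg; have mT : measurable_fun setT (fun p => (f p.1, g p.1 p.2)).
  apply/measurable_fun_pairP; split => //.
  by apply: (measurableT_comp sf.1); exact: measurable_fst.
split=> // A mA.
rewrite -[LHS]/(\int[m1]_x m2 (xsection ((fun p => (f p.1, g p.1 p.2)) @^-1` A) x))%E.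
rewrite (eq_integral (fun x => (c2%:E * (m2 \o xsection A) (f x))%E)); last first.
  move=> x _; rewrite /= -(sg x).2; last exact: measurable_xsection.
  by congr (m2 _); apply/seteqP; split => y; rewrite /xsection/= !inE.
rewrite ge0_integralZl//; last first.
  exact: (measurableT_comp (measurable_fun_xsection m2 mA) sf.1).
rewrite (integral_scales c10 sf)//; last exact: measurable_fun_xsection.
by rewrite muleA -EFinM mulrC.
Qed.

Lemma scales_product_ysection c1 c2 (f : T2 -> T1 -> T1) (g : T2 -> T2) :
  0 <= c1 -> 0 <= c2 -> (forall y, scales m1 c1 (f y)) -> scales m2 c2 g ->
  measurable_fun setT (fun p : T1 * T2 => f p.2 p.1) ->
  scales (m1 \x m2)%E (c1 * c2) (fun p => (f p.2 p.1, g p.2)).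
Proof.
move=> c10 c20 sf sg mf; have mT : measurable_fun setT (fun p => (f p.2 p.1, g p.2)).
  apply/measurable_fun_pairP; split => //.
  by apply: (measurableT_comp sg.1); exact: measurable_snd.
split=> // A mA.
rewrite !product_measure1_ysection//; last exact: measurable_preimage.
rewrite (eq_integral (fun y => (c1%:E * (m1 \o ysection A) (g y))%E)); last first.
  move=> y _; rewrite /= -(sf y).2; last exact: measurable_ysection.
  by congr (m1 _); apply/seteqP; split => x; rewrite /ysection/= !inE.
rewrite ge0_integralZl//; last first.
  exact: (measurableT_comp (measurable_fun_ysection m1 mA) sg.1).
rewrite (integral_scales c20 sg)//; last exact: measurable_fun_ysection.
by rewrite muleA -EFinM.
Qed.

End product.

(** Lebesgue measure is determined by its values on the intervals []p, q]], so it suffices to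
    compute the lengths of their preimages. *)
Lemma scales_lebesgue (a b : R) : a != 0 ->
  scales (@lebesgue_measure R) `|a|^-1
    (fun x : measurableTypeR R => a * x + b : measurableTypeR R).
Proof.
move=> a0; pose f (x : measurableTypeR R) : measurableTypeR R := a * x + b.
rewrite -/f; have mf : measurable_fun setT f.
  by apply: measurable_funD => //; exact: mulrl_measurable.
split=> // A mA; have ca : 0 <= `|a| by [].
suff -> : lebesgue_measure A = (`|a|%:E * lebesgue_measure (f @^-1` A))%E.
  by rewrite muleA -EFinM mulVf ?normr_eq0// mul1e.
unshelve apply: (@lebesgue_measure_unique R (mscale (NngNum ca)
  (pushforward (@lebesgue_measure R) f)) _ A mA) => //= _ [[p q] _ <-].
rewrite /mscale/= /pushforward.
have [agt0|alt0|a00] := ltgtP 0 a; last by rewrite -a00 eqxx in a0.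
  rewrite (_ : _ @^-1` _ = `](p - b) / a, (q - b) / a]%classic); last first.
    apply/seteqP; split => x /=; rewrite !in_itv/= /f ltr_pdivrMr// ler_pdivlMr//;
    by move=> /andP[? ?]; apply/andP; split; lra.
  rewrite !lebesgue_measure_itv/= !lte_fin ltr_pM2r ?invr_gt0// ltrBlDr subrK.
  case: ifPn => _; last by rewrite mule0.
  by rewrite -!EFinB -EFinM gtr0_norm//; congr EFin; field.
(* A negative slope swaps the endpoints and moves the closed end, without effect on the length. *)
rewrite (_ : _ @^-1` _ = `[(q - b) / a, (p - b) / a[%classic); last first.
  apply/seteqP; split => x /=; rewrite !in_itv/= /f ltr_ndivlMr// ler_ndivrMr//;
  by move=> /andP[? ?]; apply/andP; split; lra.
rewrite !lebesgue_measure_itv/= !lte_fin ltr_nM2r ?invr_lt0// ltrBlDr subrK.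
case: ifPn => _; last by rewrite mule0.
by rewrite -!EFinB -EFinM ltr0_norm//; congr EFin; field.
Qed.

End measure_scaling.

(** * Affine maps and the Borel product measure *)

Section borel_lebesgue_affine.
Context {R : realType}.

Lemma measurable_affine m n (M : 'M[R]_(m, n)) (b : 'cV[R]_m) :
  measurable_fun setT (fun x : 'cV[R]_n => M *m x + b).
Proof.
apply: measurable_fun_cV_coordP => i.
rewrite (_ : _ \o _ = fun x => \sum_j M i j * cV_coord j x + b i 0); last first.
  by apply/funext => x; rewrite /cV_coord /= !mxE.
apply: measurable_funD => //; apply: measurable_sum => j.
by apply: measurable_funM => //; exact: measurable_cV_coord.
Qed.

Lemma scales_consv n c (S : measurableTypeR R * 'cV[R]_n -> measurableTypeR R * 'cV[R]_n)
    (T : 'cV[R]_n.+1 -> 'cV[R]_n.+1) :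
  scales (lebesgue_measure \x borel_lebesgue n)%E c S ->
  measurable_fun setT T -> (forall p, T (consv p) = consv (S p)) ->
  scales (borel_lebesgue n.+1) c T.
Proof.
move=> [mS sS] mT TS; split=> // A mA.
rewrite -[LHS]/((lebesgue_measure \x borel_lebesgue n)%E (@consv R n @^-1` (T @^-1` A))).
rewrite -[X in (_ * X)%E]/((lebesgue_measure \x borel_lebesgue n)%E (@consv R n @^-1` A)).
rewrite -sS; last exact: (measurable_preimage (@measurable_consv R n)).
by congr ((_ \x _)%E _); apply/seteqP; split => p /=; rewrite TS.
Qed.

(** The new first coordinate depends on the old one alone. With that one frozen at [x], the others
    undergo [W] and a translation depending on [x], hence the assumption for every [b']. *)
Lemma scales_lower_block n (a : R) (v : 'cV[R]_n) (W : 'M[R]_n) (b : 'cV[R]_(1 + n)) :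
  a != 0 ->
  (forall b', scales (borel_lebesgue n) `|\det W|^-1 (fun x => W *m x + b')) ->
  scales (borel_lebesgue n.+1) (`|a|^-1 * `|\det W|^-1)
    (fun x => block_mx a%:M 0 v W *m x + b).
Proof.
move=> a0 sW.
pose f (x : measurableTypeR R) : measurableTypeR R := a * x + usubmx b 0 0.
pose g (x : measurableTypeR R) y := W *m y + (x *: v + dsubmx b).
apply: (@scales_consv n _ (fun p => (f p.1, g p.1 p.2))).
- apply: scales_product_xsection; rewrite ?invr_ge0//.
  + exact: scales_lebesgue.
  + by move=> x; exact: sW.
  + rewrite (_ : (fun _ => _) = (fun x : 'cV[R]_n.+1 => row_mx v W *m x + dsubmx b)
        \o @consv R n).
      exact: (measurableT_comp (measurable_affine _ _) (@measurable_consv R n)).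
    apply/funext => p /=; rewrite /consv (@mul_row_col _ _ 1)/= mul_mx_scalar.
    by rewrite /g addrA [W *m _ + _]addrC.
- exact: measurable_affine.
- move=> p; rewrite /consv -[in LHS](@vsubmxK _ 1 n 1 b) (@mul_block_col _ 1 n 1 n 1).
  rewrite (@add_col_mx _ 1 n 1) mul0mx addr0 mul_mx_scalar.
  apply: (congr2 (@col_mx R 1 n 1)).
    by apply/matrixP => i j; rewrite !ord1 /f !mxE eqxx !mulr1n mulrC.
  by rewrite mul_mx_scalar /g addrA [W *m _ + _]addrC.
Qed.

(** With the tail [y] frozen, the first coordinate is only translated by [u *m y], so here the
    slices are taken at fixed tail. *)
Lemma scales_upper_shear n (u : 'rV[R]_n) :
  scales (borel_lebesgue n.+1) 1
    (fun x => block_mx 1%:M u 0 1%:M *m x + 0 : 'cV[R]_(1 + n)).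
Proof.
pose f (y : 'cV[R]_n) (x : measurableTypeR R) : measurableTypeR R := 1 * x + (u *m y) 0 0.
apply: (@scales_consv n _ (fun p => (f p.2 p.1, id p.2))).
- rewrite -[1]mulr1; apply: (scales_product_ysection (g := id)) => //.
  + by move=> y; have := scales_lebesgue ((u *m y) 0 0) (oner_neq0 R); rewrite normr1 invr1.
  + exact: scales_id.
  + rewrite (_ : (fun _ => _) = (fun x : 'cV[R]_n.+1 => cV_coord 0 (row_mx 1%:M u *m x + 0))
        \o @consv R n).
      apply: (measurableT_comp _ (@measurable_consv R n)).
      exact: (measurableT_comp (@measurable_cV_coord R 1 0) (measurable_affine _ _)).
    apply/funext => p /=; rewrite /consv (@mul_row_col _ _ 1)/= mul1mx addr0.
    by rewrite /cV_coord/= !mxE eqxx mulr1n /f mul1r !mxE.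
- exact: measurable_affine.
- move=> p; rewrite addr0 /consv (@mul_block_col _ 1 n 1 n 1) !mul1mx mul0mx add0r.
  apply: (congr2 (@col_mx R 1 n 1)) => //.
  by apply/matrixP => i j; rewrite !ord1 /f !mxE eqxx !mulr1n mul1r.
Qed.

Lemma dotmx_neq0 n (u : 'rV[R]_n) : u != 0 -> (u *m u^T) 0 0 != 0.
Proof.
apply: contraNneq => /=; rewrite mxE => /eqP; rewrite psumr_eq0; last first.
  by move=> j _; rewrite mxE -expr2 sqr_ge0.
move=> /allP uu; apply/eqP/rowP => j; rewrite mxE.
by have /implyP/(_ isT) := uu j (mem_index_enum _); rewrite mxE mulf_eq0 orbb => /eqP.
Qed.

Lemma scales_affine n (M : 'M[R]_n) (b : 'cV[R]_n) : M \in unitmx ->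
  scales (borel_lebesgue n) `|\det M|^-1 (fun x => M *m x + b).
Proof.
elim: n M b => [|n IH] M b uM.
  rewrite det_mx00 normr1 invr1 (_ : (fun _ => _) = id); first exact: scales_id.
  by apply/funext => x; apply/colP => -[].
(* Block elimination with pivot [a]: the lower right block [W] is the Schur complement, to which the
   induction hypothesis applies. *)
have pivot (N : 'M[R]_(1 + n)) c : N \in unitmx -> ulsubmx N 0 0 != 0 ->
    scales (borel_lebesgue n.+1) `|\det N|^-1 (fun x => N *m x + c).
  set a := ulsubmx N 0 0 => uN a0.
  pose u := ursubmx N; pose v := dlsubmx N.
  pose W := drsubmx N - a^-1 *: (v *m u).
  have NE : N = block_mx a%:M 0 v W *m block_mx 1%:M (a^-1 *: u) 0 1%:M.
    rewrite mulmx_block !mulmx1 !mul0mx !mulmx0 !addr0 mul_scalar_mx scalerA.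
    rewrite divff// scale1r -scalemxAr /W addrC subrK -[a%:M]mx11_scalar.
    by rewrite submxK.
  have dN : \det N = a * \det W.
    by rewrite NE det_mulmx det_lblock det_ublock !det1 !mulr1 det_scalar expr1.
  have uW : W \in unitmx.
    by move: uN; rewrite !unitmxE dN !unitfE mulf_eq0 negb_or => /andP[].
  rewrite dN normrM invfM -[X in scales _ X]mul1r.
  rewrite (_ : (fun _ => _) = (fun x => block_mx a%:M 0 v W *m x + c) \o
      (fun x : 'cV[R]_(1 + n) => block_mx 1%:M (a^-1 *: u) 0 1%:M *m x + 0)); last first.
    by apply/funext => x /=; rewrite addr0 mulmxA -NE.
  apply: scales_comp; last exact: scales_upper_shear.
  by apply: scales_lower_block => // b'; exact: IH.
pose M' : 'M[R]_(1 + n) := M.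
have [a0|] := eqVneq (ulsubmx M' 0 0) 0; last exact: pivot.
(* A zero pivot is made nonzero by adding multiples of the other columns to the first one. *)
pose u := ursubmx M'.
(* Otherwise the whole first row vanishes, and the determinant with it. *)
have u0 : u != 0.
  apply: contraTneq uM => u0; rewrite unitmxE unitfE negbK.
  have ME : M' = block_mx (ulsubmx M') 0 (dlsubmx M') (drsubmx M').
    by rewrite -u0 submxK.
  rewrite -[\det M]/(\det M') ME det_lblock [ulsubmx _]mx11_scalar a0.
  by rewrite det_scalar expr1 mul0r.
(* The multiples are the entries of [u] itself: right multiplication by [N 1] turns the zero corner
   into [u *m u^T], a nonzero sum of squares, and [N (-1)] undoes it. *)
pose N (s : R) : 'M[R]_(1 + n) := block_mx 1%:M 0 (s *: u^T) 1%:M.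
have NK : N 1 *m N (-1) = 1%:M.
  rewrite /N mulmx_block !mulmx1 !mul1mx !mul0mx !mulmx0 !addr0 !add0r.
  by rewrite -scalerDl subrr scale0r -scalar_mx_block.
have dN s : \det (N s) = 1 by rewrite det_lblock !det1 mulr1.
have uN s : N s \in unitmx by rewrite unitmxE dN unitr1.
have -> : \det M = \det (M' *m N 1) by rewrite det_mulmx dN mulr1.
rewrite -[X in scales _ X]mul1r.
rewrite (_ : (fun _ => _) = (fun x => M' *m N 1 *m x + b) \o
    (fun x : 'cV[R]_(1 + n) => N (-1) *m x + 0)); last first.
  by apply/funext => x /=; rewrite addr0 -!mulmxA [N 1 *m _]mulmxA NK mul1mx.
apply: scales_comp.
  apply: pivot; first by rewrite unitmx_mul uM uN.
  rewrite -[M']submxK /N mulmx_block block_mxKul mulmx1 scale1r mxE a0 add0r.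
  exact: dotmx_neq0.
rewrite (_ : 1 = `|1|^-1 * `|\det (1%:M : 'M[R]_n)|^-1); last first.
  by rewrite det1 normr1 invr1 mulr1.
apply: scales_lower_block; first exact: oner_neq0.
by move=> b'; apply: IH; exact: unitmx1.
Qed.

End borel_lebesgue_affine.

(** * Affine maps and the completed Lebesgue measure *)

Section completion_scaling.
Context d (T : measurableType d) {R : realType}.
Variable mu : {measure set T -> \bar R}.
Implicit Types (c : R) (f g : T -> T).

(** A countable measurable cover of an arbitrary [X] pulls back to a cover of its preimage, with
    total mass multiplied by [c]. *)
Lemma mu_ext_preimage_le c f X : 0 < c -> scales mu c f ->
  (mu_ext mu (f @^-1` X) <= c%:E * mu_ext mu X)%E.
Proof.
move=> c0 [mf sf]; rewrite muleC -lee_pdivrMr//.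
apply: le_ereal_inf_tmp => _ [A [mA XA] <-].
rewrite lee_pdivrMr//.
apply: ereal_inf_lbound; exists (fun k => f @^-1` A k).
  split=> [k|x /XA [k _ Ak]]; last by exists k.
  exact: measurable_preimage.
under eq_eseriesr do rewrite sf//.
by rewrite nneseriesZl// muleC.
Qed.

Lemma scales_inverse c f g : 0 < c -> cancel f g ->
  measurable_fun setT g -> scales mu c f -> scales mu c^-1 g.
Proof.
move=> c0 fK mg [mf sf]; split=> // A mA.
have <- : f @^-1` (g @^-1` A) = A.
  by apply/seteqP; split => x; rewrite /preimage/= fK.
rewrite sf; last exact: measurable_preimage.
rewrite muleA -EFinM mulVf ?gt_eqF// mul1e.
by congr (mu _); apply/seteqP; split => x; rewrite /preimage/= fK.
Qed.

(** The reverse inequality is the same bound for the inverse [g], with factor [c^-1]. *)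
Lemma mu_ext_preimage c f g X : 0 < c -> cancel f g -> cancel g f ->
  measurable_fun setT g -> scales mu c f ->
  mu_ext mu (f @^-1` X) = (c%:E * mu_ext mu X)%E.
Proof.
move=> c0 fK gK mg sf; apply/eqP; rewrite eq_le mu_ext_preimage_le//=.
have ci : 0 < c^-1 by rewrite invr_gt0.
have := mu_ext_preimage_le (f @^-1` X) ci (scales_inverse c0 fK mg sf).
rewrite (_ : g @^-1` _ = X); last first.
  by apply/seteqP; split => x; rewrite /preimage/= gK.
by rewrite -(@lee_pmul2l _ c%:E)// muleA -EFinM mulfV ?gt_eqF// mul1e.
Qed.

Lemma scales_completion c f g : 0 < c -> cancel f g -> cancel g f ->
  measurable_fun setT g -> scales mu c f ->
  scales (@completed_measure_extension _ T R mu) c f.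
Proof.
move=> c0 fK gK mg sf; have muf X := mu_ext_preimage X c0 fK gK mg sf.
split=> [_ A mA|A mA]; last exact: muf.
rewrite setTI -[measurable _]/(caratheodory_measurable (mu_ext mu) (f @^-1` A)) => X.
(* Every test set is a preimage under [f], so the Caratheodory identity for the preimage of [A] is
   [c] times the one for [A]. *)
have -> : X = f @^-1` (g @^-1` X).
  by apply/seteqP; split => x; rewrite /preimage/= fK.
rewrite preimage_setC -!preimage_setI !muf (mA (g @^-1` X)).
by rewrite muleDr// ge0_adde_def// inE mu_ext_ge0.
Qed.

End completion_scaling.

Lemma scales_lebesgue_cV {R : realType} n (M : 'M[R]_n) (b : 'cV[R]_n) :
  M \in unitmx -> scales (lebesgue_cV R n) `|\det M|^-1 (fun x => M *m x + b).
Proof.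
move=> uM.
have detM : 0 < `|\det M|^-1.
  by rewrite invr_gt0 normr_gt0 -unitfE -unitmxE.
apply: (scales_completion (g := fun y => invmx M *m y + - (invmx M *m b))) => //.
- by move=> x; rewrite mulmxDr mulKmx// addrK.
- by move=> x; rewrite mulmxDr mulmxN !mulKVmx// subrK.
- exact: measurable_affine.
- exact: scales_affine.
Qed.

(** * Change of variables for integrable functions *)

Section integral_scaling.
Context d (T : measurableType d) {R : realType}.
Variable mu : {measure set T -> \bar R}.

Lemma integrable_scales c f (h : T -> \bar R) : 0 <= c -> scales mu c f ->
  mu.-integrable setT h -> mu.-integrable setT (h \o f).
Proof.
move=> c0 sf /integrableP[mh ih]; apply/integrableP; split.
  by apply: measurableT_comp => //; exact: sf.1.
rewrite (integral_scales (h := abse \o h) c0 sf)/=.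
- by rewrite lte_mul_pinfty.
- exact: measurableT_comp.
- by move=> x; exact: abse_ge0.
Qed.

Lemma integrable_integral_scales c f (h : T -> \bar R) : 0 <= c ->
  scales mu c f -> mu.-integrable setT h ->
  (\int[mu]_x h (f x) = c%:E * \int[mu]_x h x)%E.
Proof.
move=> c0 sf ih; have mh := measurable_int _ ih.
rewrite (integralE _ _ (h \o f)) funepos_comp funeneg_comp.
rewrite (integral_scales c0 sf) ?(integral_scales c0 sf)//; last 2 first.
- exact: measurable_funeneg.
- exact: measurable_funepos.
rewrite (integralE _ _ h) [RHS]muleBr//; apply: fin_num_adde_defl.
rewrite fin_numN; exact: integrable_neg_fin_num.
Qed.

End integral_scaling.

(** * Borel sets of column vectors *)

Section borel_cV_topology.
Context {R : realType} {n : nat}.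

Lemma measurable_ball_cV (x : 'cV[R]_n) (e : R) : 0 < e -> measurable (ball x e).
Proof.
move=> e0; have -> : ball x e = \bigcap_(i : 'I_n) (cV_coord i @^-1` ball (x i 0) e).
  apply/seteqP; split => y; first by move=> [_ xy] i _; exact: xy.
  by move=> xy; split=> // i j; rewrite ord1; exact: xy.
apply: fin_bigcap_measurable => // i _.
apply: measurable_preimage; first exact: measurable_cV_coord.
exact: measurable_ball.
Qed.

(* An open set is the union of the balls it contains with rational center and
   radius [1 / (k + 1)]. *)
Lemma open_measurable_cV (U : set 'cV[R]_n) : open U -> measurable U.
Proof.
move=> oU; pose B (p : 'cV[rat]_n * nat) : set 'cV[R]_n :=
  ball (map_mx (ratr : rat -> R) p.1) p.2.+1%:R^-1.
have -> : U = \bigcup_(p in [set p | B p `<=` U]) B p.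
  apply/seteqP; split => [x Ux|x [p BU /BU//]].
  have /nbhs_ballP[e /= e0 xeU] : nbhs x U by exact: open_nbhs_nbhs.
  (* With radius below [e / 2], a ball containing [x] stays within [e] of [x], by the triangle
     inequality through its center. *)
  have [k ke] : exists k, k.+1%:R^-1 < e / 2.
    have := @near_infty_natSinv_lt R (PosNum (divr_gt0 e0 (ltr0n R 2))).
    by move=> [N _ /(_ N (leqnn N))]; exists N.
  have k0 : 0 < k.+1%:R^-1 :> R by rewrite invr_gt0.
  have /choice[q xq] i : exists q : rat, `|ratr q - x i 0| < k.+1%:R^-1.
    have xlt : x i 0 < x i 0 + k.+1%:R^-1 by rewrite ltrDl.
    have [q] := rat_in_itvoo xlt; rewrite in_itv/= => /andP[xq qx].
    by exists q; rewrite ger0_norm ?subr_ge0 ?ltW// ltrBlDl.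
  have Bx : B (\col_i q i, k) x by split=> // i j; rewrite !mxE ord1 /ball/=; exact: xq.
  exists (\col_i q i, k) => // y By; apply: xeU.
  rewrite (splitr e); apply: ball_triangle.
    by apply: ball_sym; apply: le_ball Bx; exact: ltW.
  by apply: le_ball By; exact: ltW.
rewrite bigcup_mkcond; apply: countable_bigcupT_measurable => // p.
by case: ifPn => // _; apply: measurable_ball_cV; rewrite invr_gt0.
Qed.

Lemma continuous_measurable_cV (f : 'cV[R]_n -> R) :
  continuous f -> measurable_fun setT f.
Proof.
move=> /continuousP cf; apply: (measurability _ (RGenOpens.measurableE R)).
move=> _ [_ [a [b ->] <-]]; rewrite setTI; apply: open_measurable_cV.
exact/cf/interval_open.
Qed.

(** Passes from the Borel sigma-algebra, where continuous and affine maps are handled, to the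
    Caratheodory one that carries [lebesgue_cV]. *)
Lemma measurable_fun_lebesgue_cV d (T : measurableType d) (f : 'cV[R]_n -> T) :
  measurable_fun setT f ->
  measurable_fun (setT : set (caratheodory_type (mu_ext (borel_lebesgue n)))) f.
Proof.
move=> mf _ A mA; rewrite setTI; apply: caratheodory_measurable_mu_ext.
exact: measurable_preimage.
Qed.

End borel_cV_topology.

(** * The determinant of a matrix exponential *)

Section derivative_of_determinant.
Context {R : realType}.

Lemma is_derive_prod_ord n (f : 'I_n -> R -> R) (df : 'I_n -> R) (x : R) :
  (forall i, is_derive x (1 : R) (f i) (df i)) ->
  is_derive x (1 : R) (fun t => \prod_i f i t)
    (\sum_i \prod_j (if j == i then df j else f j x)).
Proof.
elim: n f df => [|n IH] f df fdf.
  under [F in is_derive _ _ F _]funext do rewrite big_ord0.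
  by rewrite big_ord0; exact: is_derive_cst.
under [F in is_derive _ _ F _]funext do rewrite big_ord_recl.
have := is_deriveM (fdf ord0) (IH _ _ (fun i => fdf (lift ord0 i))).
move/is_derive_eq; apply; rewrite big_ord_recl /= addrC; congr (_ + _).
  rewrite big_ord_recl eqxx mulrC; congr (_ * _).
rewrite scaler_sumr; apply: eq_bigr => i _.
by rewrite big_ord_recl.
Qed.

Lemma is_derive_det n (F : R -> 'M[R]_n) (dF : 'M[R]_n) (x : R) :
  (forall i j, is_derive x (1 : R) (fun t => F t i j) (dF i j)) ->
  is_derive x (1 : R) (fun t => \det (F t)) (\tr (dF *m \adj (F x))).
Proof.
move=> FdF.
(* [A i] is [F x] with row [i] replaced by that of [dF]; expansion along this row gives the [i]-th
   diagonal entry of [dF *m \adj (F x)]. The sum of their determinants is also what the product rule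
   yields on the Leibniz formula. *)
pose A i := \matrix_(j, k) (if j == i then dF j k else F x j k).
have -> : \tr (dF *m \adj (F x)) = \sum_i \det (A i).
  rewrite /mxtrace; apply: eq_bigr => i _.
  rewrite (expand_det_row (A i) i) mxE; apply: eq_bigr => k _.
  rewrite !mxE eqxx; congr (_ * (_ * \det _)).
  by apply/matrixP => j l; rewrite !mxE eq_sym (negbTE (neq_lift _ _)).
rewrite /determinant exchange_big/=.
rewrite (_ : (fun t => _) = \sum_(s : 'S_n) (fun t => (-1) ^+ s * \prod_i F t i (s i))); last first.
  by apply/funext => t; rewrite fct_sumE.
elim/big_ind2 : _ => [|f df g dg fP gP|s _].
- exact: is_derive_cst.
- exact: is_deriveD.
- rewrite -mulr_sumr.
  have := is_deriveZ ((-1) ^+ s) (is_derive_prod_ord (fun i => FdF i (s i))).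
  move/is_derive_eq; apply; rewrite /GRing.scale/=; congr (_ * _).
  by apply: eq_bigr => i _; apply: eq_bigr => j _; rewrite mxE.
Qed.

End derivative_of_determinant.

(** * The matrix exponential through the power series of its entries *)

Section matrix_exponential.
Context {R : realType} {n : nat}.
Implicit Types (C : 'M[R]_n) (t : R).

(** The sum of the absolute values of all entries dominates every row sum, so the bound passes from
    one power to the next. *)
Lemma norm_expr_mx_le C k i j :
  `|(C ^+ k) i j| <= (\sum_p \sum_q `|C p q|) ^+ k.
Proof.
elim: k i j => [|k IH] i j.
  by rewrite !expr0 mxE; case: eqP; rewrite ?normr1// normr0.
rewrite exprS -mulmxE mxE exprS.
apply: (le_trans (ler_norm_sum _ _ _)).
apply: (@le_trans _ _ (\sum_q `|C i q| * (\sum_p \sum_q `|C p q|) ^+ k)).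
  by apply: ler_sum => q _; rewrite normrM ler_wpM2l.
rewrite -mulr_suml ler_wpM2r//.
  by rewrite exprn_ge0// sumr_ge0// => p _; rewrite sumr_ge0.
rewrite [leRHS](bigD1 i)//= lerDl sumr_ge0// => p _; exact: sumr_ge0.
Qed.

(* The coefficients of the [m]-th derivative of the [(i, j)] entry of [t |-> expmx (t *: C)]. *)
Definition expmx_coef C m i j k : R := (k`!%:R)^-1 * (C ^+ (k + m)) i j.

Lemma pseries_diffs_expmx_coef C m i j :
  pseries_diffs (expmx_coef C m i j) = expmx_coef C m.+1 i j.
Proof.
apply/funext => k; rewrite /pseries_diffs /expmx_coef addSnnS mulrA.
by congr (_ * _); rewrite factS natrM invfM mulVKf.
Qed.

(** Comparison with the real series of K^m exp(K|t|), where K is the sum of the absolute values of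
    the entries of [C]. *)
Lemma is_cvg_pseries_expmx_coef C m i j t : cvgn (pseries (expmx_coef C m i j) t).
Proof.
set K := \sum_p \sum_q `|C p q|.
have K0 : 0 <= K by apply: sumr_ge0 => p _; exact: sumr_ge0.
apply: normed_cvg; apply: (@series_le_cvg _ _ (fun k => K ^+ m * exp_coeff (K * `|t|) k)).
- by move=> k; exact: normr_ge0.
- by move=> k; rewrite mulr_ge0 ?exprn_ge0// exp_coeff_ge0// mulr_ge0.
- move=> k; rewrite /= /expmx_coef exp_coeffE !normrM normrX mulrCA.
  rewrite ger0_norm ?invr_ge0// -mulrA ler_wpM2l ?invr_ge0//.
  rewrite exprMn mulrA -exprD addnC ler_wpM2r ?exprn_ge0//.
  exact: norm_expr_mx_le.
- apply: is_cvg_seriesZ; exact: is_cvg_series_exp_coeff.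
Qed.

Lemma cvg_mx (u : nat -> 'M[R]_n) (L : 'M[R]_n) :
  (forall i j, (fun k => u k i j) @ \oo --> L i j) -> u @ \oo --> L.
Proof.
move=> uL; apply/cvg_ballP => e e0.
have : \forall k \near \oo, forall i j, ball (L i j) e (u k i j).
  apply: filter_forall => i; apply: filter_forall => j.
  by have /cvg_ballP/(_ e e0) := uL i j.
by apply: filterS => k uLk; split.
Qed.

Lemma expr_scalemx C t k : (t *: C) ^+ k = t ^+ k *: C ^+ k.
Proof.
elim: k => [|k IH]; first by rewrite !expr0 scale1r.
by rewrite !exprS IH -!mulmxE -scalemxAl -scalemxAr scalerA.
Qed.

Lemma expmxE C t i j :
  expmx (t *: C) i j = limn (pseries (expmx_coef C 0 i j) t).
Proof.
pose L : 'M[R]_n := \matrix_(i, j) limn (pseries (expmx_coef C 0 i j) t).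
suff : series (fun k : nat => (k`!%:R)^-1 *: (t *: C) ^+ k) @ \oo --> L.
  by move=> /(cvg_lim (@norm_hausdorff _ _)) H; rewrite /expmx H mxE.
apply: cvg_mx => {}i {}j; rewrite mxE.
rewrite (_ : (fun k => _) = pseries (expmx_coef C 0 i j) t).
  exact: is_cvg_pseries_expmx_coef.
apply/funext => N; rewrite /series/= summxE; apply: eq_bigr => k _.
rewrite expr_scalemx 2!mxE /= /expmx_coef addn0; ring.
Qed.

Lemma lim_pseries_expmx_coef1 C t i j :
  limn (pseries (expmx_coef C 1 i j) t) = (C *m expmx (t *: C)) i j.
Proof.
apply: cvg_lim => //.
rewrite (_ : pseries _ t = fun N => \sum_l C i l * pseries (expmx_coef C 0 l j) t N).
  rewrite mxE; apply: cvg_big => [|l _]; [exact: add_continuous|apply: cvgMl_tmp].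
  by rewrite expmxE; exact: is_cvg_pseries_expmx_coef.
apply/funext => N; rewrite /pseries /series/=.
under [RHS]eq_bigr do rewrite mulr_sumr.
rewrite exchange_big/=; apply: eq_bigr => k _.
rewrite /expmx_coef addn1 exprS -mulmxE mxE mulr_sumr mulr_suml.
by apply: eq_bigr => l _; rewrite addn0; ring.
Qed.

(** Splitting [C] off on the right of each power, instead of the left, gives the other product for
    the same series. *)
Lemma expmx_comm C t : C *m expmx (t *: C) = expmx (t *: C) *m C.
Proof.
apply/matrixP => i j; rewrite -lim_pseries_expmx_coef1.
apply: cvg_lim => //.
rewrite (_ : pseries _ t = fun N => \sum_l pseries (expmx_coef C 0 i l) t N * C l j).
  rewrite mxE; apply: cvg_big => [|l _]; [exact: add_continuous|apply: cvgMr_tmp].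
  by rewrite expmxE; exact: is_cvg_pseries_expmx_coef.
apply/funext => N; rewrite /pseries /series/=.
under [RHS]eq_bigr do rewrite mulr_suml.
rewrite exchange_big/=; apply: eq_bigr => k _.
rewrite /expmx_coef addn1 exprSr -mulmxE mxE mulr_sumr mulr_suml.
by apply: eq_bigr => l _; rewrite addn0; ring.
Qed.

Lemma is_derive_expmx C t i j :
  is_derive t (1 : R) (fun s => expmx (s *: C) i j) ((C *m expmx (t *: C)) i j).
Proof.
under [F in is_derive _ _ F _]funext do rewrite expmxE.
rewrite -lim_pseries_expmx_coef1 -pseries_diffs_expmx_coef.
(* Term by term differentiation needs convergence at some point beyond |t|; these series converge
   everywhere. *)
apply: (@pseries_snd_diffs _ _ (`|t| + 1)).
- exact: is_cvg_pseries_expmx_coef.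
- by rewrite pseries_diffs_expmx_coef; exact: is_cvg_pseries_expmx_coef.
- by rewrite !pseries_diffs_expmx_coef; exact: is_cvg_pseries_expmx_coef.
- by rewrite [ltRHS]ger0_norm ?addr_ge0// ltrDl.
Qed.

Lemma expmx0 : expmx (0 : 'M[R]_n) = 1%:M.
Proof.
rewrite /expmx; apply: (cvg_lim (@norm_hausdorff _ _)).
apply: cvg_near_cst; near=> m; rewrite -[m]prednK; last by near: m.
rewrite /series/= big_nat_recl//= expr0 fact0 invr1 scale1r big1 ?addr0//.
by move=> k _; rewrite exprS mul0r scaler0.
Unshelve. all: by end_near. Qed.

(** The product of the exponentials of sC and -sC has zero derivative in s, as [C] commutes with the
    first, so it keeps its value at s = 0. *)
Lemma expmxK C t : expmx (t *: C) *m expmx (- t *: C) = 1%:M.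
Proof.
pose f i j s := (expmx (s *: C) *m expmx (s *: (- C))) i j.
apply/matrixP => i j; rewrite scaleNr -scalerN -[LHS]/(f i j t).
have -> : f i j t = f i j 0.
  apply: is_derive_0_is_cst => s.
  rewrite /f; under [F in is_derive _ _ F _]funext do rewrite mxE.
  rewrite -[F in is_derive _ _ F _]fct_sumE.
  have D l := is_deriveM (is_derive_expmx C s i l) (is_derive_expmx (- C) s l j).
  have /is_derive_eq := is_derive_sum D; apply.
  rewrite big_split/=.
  have -> : \sum_(l < n) expmx (s *: - C) l j *: (C *m expmx (s *: C)) i l =
     (C *m expmx (s *: C) *m expmx (s *: - C)) i j.
    by rewrite [RHS]mxE; apply: eq_bigr => l _; exact: mulrC.
  have -> : \sum_(l < n) expmx (s *: C) i l *: (- C *m expmx (s *: - C)) l j =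
     (expmx (s *: C) *m (- C *m expmx (s *: - C))) i j.
    by rewrite [RHS]mxE.
  by rewrite mulNmx mulmxN mulmxA expmx_comm [X in X + _]mxE addNr.
by rewrite /f !scale0r expmx0 mul1mx.
Qed.

Lemma det_expmx C t : \det (expmx (t *: C)) = expR (t * \tr C).
Proof.
pose f s := \det (expmx (s *: C)) * expR (s * - \tr C).
have : f t = f 0.
  apply: is_derive_0_is_cst => s.
  have D1 := is_derive_det (is_derive_expmx C s).
  have D2 : is_derive s (1 : R) (fun s => expR (s * - \tr C))
      (expR (s * - \tr C) * - \tr C).
    have D := is_deriveM (is_derive_id s (1 : R)) (is_derive_cst (- \tr C) s (1 : R)).
    have /is_derive_eq := is_derive1_comp (is_derive_expR _) D.
    by apply; rewrite scaler0 add0r /GRing.scale/= mulr1.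
  have /is_derive_eq := is_deriveM D1 D2; apply.
  (* Since E adj(E) = det(E) I, Jacobi's formula gives the derivative tr(C) det(E), which cancels
     the contribution of the scalar exponential. *)
  rewrite -mulmxA mul_mx_adj mul_mx_scalar mxtraceZ /GRing.scale/=; ring.
rewrite /f scale0r expmx0 det1 mul0r expR0 mulr1 mulrN expRN => H.
have e0 : expR (t * \tr C) != 0 by rewrite gt_eqF ?expR_gt0.
by apply: (mulIf (invr_neq0 e0)); rewrite H divff.
Qed.

End matrix_exponential.

(** * Superpositions of Dirac distributions along an affine map *)

Section affine_superposition.
Context {R : realType} {d : nat}.
Implicit Types (psi phi : 'cV[R]_d -> R) (M : 'M[R]_d) (b : 'cV[R]_d).

Lemma schwartz_le_seminorm phi x : schwartz phi -> `|phi x| <= seminorm 0 [::] phi.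
Proof.
move=> [_ phib]; apply: (ub_le_sup (phib 0%N [::])).
by exists x => //=; rewrite expr0 mul1r.
Qed.

(** A Schwartz function is continuous, hence Borel, and bounded by its order-zero seminorm; that
    multiple of |psi| dominates. *)
Lemma integrable_L1M psi phi M b : L1 psi -> schwartz phi ->
  L1 (fun x => psi x * phi (b + M *m x)).
Proof.
move=> psi1 sphi.
have mphi : measurable_fun
    (setT : set (caratheodory_type (mu_ext (borel_lebesgue d))))
    (fun x : 'cV[R]_d => phi (b + M *m x)).
  apply: measurable_fun_lebesgue_cV.
  under eq_fun do rewrite addrC.
  apply: (measurableT_comp _ (measurable_affine M b)).
  exact: (continuous_measurable_cV (sphi.1 [::]).1).
have mpsi : measurable_fun
    (setT : set (caratheodory_type (mu_ext (borel_lebesgue d)))) psi.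
  by apply/measurable_EFinP; exact: (measurable_int _ psi1).
have ig := integrableZl measurableT (seminorm 0 [::] phi) psi1.
apply: (le_integrable _ _ _ ig) => // [|x _].
  by apply/measurable_EFinP; exact: measurable_funM.
rewrite -EFinM !abse_EFin lee_fin !normrM mulrC ler_wpM2r//.
by rewrite (le_trans (schwartz_le_seminorm _ sphi))// ler_norm.
Qed.

Lemma tempered_distribution_affine psi M b : L1 psi ->
  tempered_distribution
    (fun phi => integral_cV (fun x => psi x * phi (b + M *m x))).
Proof.
move=> psi1; split.
  move=> a f g sf sg; rewrite /integral_cV -RintegralZl//; last exact: integrable_L1M.
  rewrite -RintegralD//; last 2 first.
  - exact: (integrableZl measurableT a (integrable_L1M M b psi1 sf)).
  - exact: integrable_L1M.
  by apply: eq_Rintegral => x _; rewrite mulrDr mulrCA.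
(* The supremum seminorm alone suffices, with the L^1 norm of [psi] as constant. *)
exists (integral_cV (fun x => `|psi x|)), [:: (0%N, [::])] => f sf.
rewrite big_seq1/= /integral_cV -RintegralZr//; last exact: integrable_abse psi1.
have i1 := integrable_L1M M b psi1 sf.
apply: (le_trans (le_normr_Rintegral _ i1)) => //.
apply: le_Rintegral => //.
- exact: integrable_abse i1.
- exact: (integrableZr measurableT _ (integrable_abse psi1)).
- by move=> x _; rewrite normrM ler_wpM2l// schwartz_le_seminorm.
Qed.

Lemma given_by_affine psi M b : L1 psi -> M \in unitmx ->
  given_by (fun phi => integral_cV (fun x => psi x * phi (b + M *m x)))
    (fun y => `|\det M|^-1 * translate b (fun x => psi (invmx M *m x)) y).
Proof.
move=> psi1 uM; pose S (y : 'cV[R]_d) := invmx M *m y + - (invmx M *m b).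
have SE y : invmx M *m (y - b) = S y by rewrite mulmxBr.
have detM : 0 < `|\det M| by rewrite normr_gt0 -unitfE -unitmxE.
(* [S] inverts the map from x to b + M x; its linear part has determinant 1/det(M), hence the factor
   |det M|. *)
have sS : scales (lebesgue_cV R d) `|\det M| S.
  have := @scales_lebesgue_cV R d (invmx M) (- (invmx M *m b)).
  by rewrite unitmx_inv det_inv normfV invrK; exact.
split.
  rewrite /L1 /translate; under eq_fun do rewrite SE.
  exact: (integrableZl measurableT _ (integrable_scales (ltW detM) sS psi1)).
move=> phi sphi.
pose h x := psi x * phi (b + M *m x).
have ih : L1 h by exact: integrable_L1M.
rewrite /distribution_of /integral_cV.
(* At [S y] the test function is evaluated at b + M (S y) = y. *)
transitivity (\int[lebesgue_cV R d]_y (`|\det M|^-1 * h (S y))); last first.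
  apply: eq_Rintegral => y _; rewrite /translate SE /h -SE mulKVmx//.
  by rewrite (addrC b) subrK mulrA.
rewrite [RHS](RintegralZl _ measurableT (integrable_scales (ltW detM) sS ih)).
rewrite /Rintegral (integrable_integral_scales (ltW detM) sS ih).
rewrite fineM//; last exact: integrable_fin_num.
by rewrite mulrA mulVf ?mul1r// gt_eqF.
Qed.

End affine_superposition.

Unset Implicit Arguments.
Set Strict Implicit.

Theorem proposition3p11 (R : realType) (dO : measure_display)
  (Omega : measurableType dO) (P : probability Omega R)
  (F : R -> set (set Omega)) (d : nat)
  (sigma C : 'M[R]_d) (alpha : 'cV[R]_d)
  (B X0 : R -> Omega -> 'cV[R]_d) (N : set Omega)
  (hP : measure_is_complete P)
  (hF : usual_conditions P F)
  (hB : brownian_motion P F B)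
  (hX0 : sde_solution B sigma C alpha P F X0 0)
  (hN : P.-negligible N)
  (hNcont : forall w, ~ N w -> continuous_path X0 w)
  (hNeq : forall w, ~ N w -> forall x : 'cV[R]_d,
     sde_equation B sigma C alpha (fun t => flow C X0 t x) x w)
  (psi : 'cV[R]_d -> R) (hpsi : L1 psi)
  (w : Omega) (hw : ~ N w) (t : R) (ht : 0 <= t) :
  let Z := X0 t w in
  let psi_t := fun x : 'cV[R]_d => psi (expmx (- t *: C) *m x) in
  tempered_distribution (Ydist C X0 t w psi) /\
  given_by (Ydist C X0 t w psi)
    (fun y => expR (- t * \tr C) * translate Z psi_t y).
Proof.
move=> Z psi_t.
have uE : expmx (t *: C) \in unitmx by have [] := mulmx1_unit (expmxK C t).
split; first exact: tempered_distribution_affine.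
have -> : expR (- t * \tr C) = `|\det (expmx (t *: C))|^-1.
  by rewrite det_expmx gtr0_norm ?expR_gt0// mulNr expRN.
rewrite /psi_t (_ : expmx (- t *: C) = invmx (expmx (t *: C))).
  exact: given_by_affine.
by rewrite -[LHS](mulKmx uE) expmxK mulmx1.
Qed.
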